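(* Let $\lambda$ be a non-zero real number, let $r$ be a positive integer, and let $u\in\mathbb{C}$ with $u\neq 1$. For every integer $n\ge 0$, $$H_{n,\lambda}(x)=\frac{1}{(1-u)^{r}}\sum_{k=0}^{n}\Bigg[\sum_{j=0}^{r}\sum_{l=0}^{[\frac{n-k}{2}]}\frac{\binom{n}{k}\binom{r}{j}(-1)_{l,\lambda}\,(n-k)!}{l!\,(n-k-2l)!}\,(-u)^{r-j}\,2^{n-2l}\,(j)_{n-k-2l,\lambda}\Bigg]h_{k,\lambda}^{(r)}(x|u),$$ where $H_{n,\lambda}(x)$ are the degenerate Hermite polynomials, $h_{k,\lambda}^{(r)}(x|u)$ are the degenerate Frobenius-Euler polynomials of order $r$, and $[y]$ denotes the greatest integer not exceeding $y$ (with the convention $0^0=1$).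
   Context: Fix a non-zero real number $\lambda$. The degenerate falling factorials are $(x)_{0,\lambda}=1$ and $(x)_{n,\lambda}=x(x-\lambda)(x-2\lambda)\cdots(x-(n-1)\lambda)$ for $n\ge 1$. The degenerate exponential functions are $e_\lambda^x(t)=(1+\lambda t)^{x/\lambda}=\sum_{n\ge 0}(x)_{n,\lambda}\frac{t^n}{n!}$, regarded as formal power series in $t$, and $e_\lambda(t)=e_\lambda^1(t)$. The degenerate Hermite polynomials $H_{n,\lambda}(x)$ are defined by $$e_\lambda^{-1}(t^2)\, e_\lambda^{x}(2t)=\sum_{n=0}^\infty H_{n,\lambda}(x)\frac{t^n}{n!}.$$ For $u\in\mathbb{C}$, $u\ne 1$, the degenerate Frobenius-Euler polynomials of order $r$ are defined by $$\bigg(\frac{1-u}{e_\lambda(t)-u}\bigg)^{r}e_\lambda^x(t)=\sum_{n=0}^\infty h_{n,\lambda}^{(r)}(x|u)\frac{t^n}{n!}.$$ *)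

(* Defs.v *)
From HB Require Import structures.
From mathcomp Require Import all_boot all_order all_algebra.
From mathcomp Require Import boolp reals.
From mathcomp Require Import complex.

Set Implicit Arguments.
Unset Strict Implicit.
Unset Printing Implicit Defensive.

Import Order.TTheory GRing.Theory Num.Theory.
Local Open Scope ring_scope.

(* A wrapper, because functions into a ring already carry the pointwise
   product. The coercion makes f n the coefficient of t^n in f. *)
Record fps (A : Type) := Fps { coef_fps :> nat -> A }.

HB.instance Definition _ (A : Type) := gen_eqMixin (fps A).
HB.instance Definition _ (A : Type) := gen_choiceMixin (fps A).

Lemma fpsP (A : Type) (f g : fps A) : f =1 g <-> f = g.
Proof. by split=> [|->//]; case: f g => [f] [g] /= /funext ->. Qed.

Section FpsZmodule.
Variable A : zmodType.
Implicit Types f g h : fps A.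

Definition fps_zero : fps A := Fps (fun=> 0).
Definition fps_opp f : fps A := Fps (fun n => - f n).
Definition fps_add f g : fps A := Fps (fun n => f n + g n).

Fact fps_addA : associative fps_add.
Proof. by move=> f g h; apply/fpsP => n /=; rewrite addrA. Qed.
Fact fps_addC : commutative fps_add.
Proof. by move=> f g; apply/fpsP => n /=; rewrite addrC. Qed.
Fact fps_add0 : left_id fps_zero fps_add.
Proof. by move=> f; apply/fpsP => n /=; rewrite add0r. Qed.
Fact fps_addN : left_inverse fps_zero fps_opp fps_add.
Proof. by move=> f; apply/fpsP => n /=; rewrite addNr. Qed.

HB.instance Definition _ :=
  GRing.isZmodule.Build (fps A) fps_addA fps_addC fps_add0 fps_addN.

Lemma coef_fps0 n : (0 : fps A) n = 0. Proof. by []. Qed.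
Lemma coef_fpsN f n : (- f) n = - f n. Proof. by []. Qed.
Lemma coef_fpsD f g n : (f + g) n = f n + g n. Proof. by []. Qed.
Lemma coef_fpsB f g n : (f - g) n = f n - g n. Proof. by []. Qed.
Lemma coef_fps_sum (I : Type) (s : seq I) (P : pred I) (F : I -> fps A) n :
  (\sum_(i <- s | P i) F i) n = \sum_(i <- s | P i) F i n.
Proof. exact: (big_morph (fun f : fps A => f n)). Qed.

End FpsZmodule.

Section FpsRing.
Variable A : comNzRingType.
Implicit Types f g h : fps A.

Definition fps_const (c : A) : fps A := Fps (fun n => if n == 0%N then c else 0).

Definition fps_mul f g : fps A :=
  Fps (fun n => \sum_(i < n.+1) f i * g (n - i)%N).

Let trunc n f : {poly A} := \poly_(i < n) f i.

Let coef_trunc n f i : (i < n)%N -> (trunc n f)`_i = f i.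
Proof. by move=> lt_in; rewrite coef_poly lt_in. Qed.

Let fps_mul_trunc n f g i :
  (i < n)%N -> fps_mul f g i = (trunc n f * trunc n g)`_i.
Proof.
move=> lt_in; rewrite coefM; apply: eq_bigr => j _.
rewrite !coef_trunc //; first exact: leq_ltn_trans (leq_subr _ _) lt_in.
by apply: leq_ltn_trans lt_in; rewrite -ltnS.
Qed.

Fact fps_mulC : commutative fps_mul.
Proof.
by move=> f g; apply/fpsP => n; rewrite !(@fps_mul_trunc n.+1) // mulrC.
Qed.

Let fps_mul3 n f g h : fps_mul f (fps_mul g h) n =
  (trunc n.+1 f * (trunc n.+1 g * trunc n.+1 h))`_n.
Proof.
rewrite /fps_mul /= coefM; apply: eq_bigr => i _.
rewrite coef_trunc // -(@fps_mul_trunc n.+1) // ltnS; exact: leq_subr.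
Qed.

Fact fps_mulA : associative fps_mul.
Proof.
move=> f g h; apply/fpsP => n.
by rewrite (fps_mulC (fps_mul f g)) !fps_mul3 mulrA [in RHS]mulrC.
Qed.

Fact fps_mul1 : left_id (fps_const 1) fps_mul.
Proof.
move=> f; apply/fpsP => n /=.
rewrite big_ord_recl /= mul1r subn0 big1 ?addr0 // => i _.
by rewrite mul0r.
Qed.

Fact fps_mulDl : left_distributive fps_mul +%R.
Proof.
move=> f g h; apply/fpsP => n /=; rewrite -big_split /=.
by apply: eq_bigr => i _; rewrite mulrDl.
Qed.

Fact fps_1_neq0 : fps_const 1 != 0.
Proof. by apply/eqP => /fpsP /(_ 0%N) /eqP; rewrite /= oner_eq0. Qed.

HB.instance Definition _ := GRing.Zmodule_isComNzRing.Build (fps A)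
  fps_mulA fps_mulC fps_mul1 fps_mulDl fps_1_neq0.

Lemma coef_fps1 n : (1 : fps A) n = (n == 0%N)%:R.
Proof. by rewrite /GRing.one /=; case: eqP. Qed.

Lemma coef_fpsM f g n : (f * g) n = \sum_(i < n.+1) f i * g (n - i)%N.
Proof. by []. Qed.

Lemma coef_fps_constM c f n : (fps_const c * f) n = c * f n.
Proof.
rewrite coef_fpsM big_ord_recl /= subn0 big1 ?addr0 // => i _.
by rewrite mul0r.
Qed.

Lemma coef_fpsM0 f g : (f * g) 0%N = f 0%N * g 0%N.
Proof. by rewrite coef_fpsM big_ord1. Qed.

Lemma coef_fpsX_lt f i k : f 0%N = 0 -> (i < k)%N -> (f ^+ k) i = 0.
Proof.
move=> f0; elim: k i => // k IHk i lt_ik.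
rewrite exprS coef_fpsM big_ord_recl f0 mul0r add0r big1 // => j _.
rewrite IHk ?mulr0 // lift0; apply: (@leq_trans i) => //.
by rewrite ltn_subrL /= (leq_ltn_trans (leq0n j)).
Qed.

Definition fps_t : fps A := Fps (fun n => (n == 1%N)%:R).

(* The substitution f(g(t)) = \sum_k f_k g(t)^k. It is only meaningful when g
   has no constant term; then g^k has order at least k, so that the terms with
   k > n do not contribute to the coefficient of t^n. *)
Definition fps_comp f g : fps A :=
  Fps (fun n => \sum_(k < n.+1) f k * (g ^+ k) n).

End FpsRing.

Section FpsUnitRing.
Variable A : comUnitRingType.
Implicit Types f g h : fps A.

Definition fps_unit : {pred fps A} := [pred f : fps A | f 0%N \is a GRing.unit].

(* 1 / f = f_0^-1 * \sum_k (1 - f / f_0)^k, a geometric series in a series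
   without constant term. *)
Definition fps_inv f : fps A :=
  if f \in fps_unit then
    fps_const (f 0%N)^-1 *
      fps_comp (Fps (fun=> 1)) (1 - fps_const (f 0%N)^-1 * f)
  else f.

Fact fps_mulVf : {in fps_unit, left_inverse 1 fps_inv *%R}.
Proof.
move=> f Uf; rewrite /fps_inv Uf.
set c := fps_const _; set g := 1 - c * f; set G := fps_comp _ g.
have g0 : g 0%N = 0.
  by rewrite coef_fpsB coef_fps1 coef_fps_constM mulVr ?subrr.
have -> : c * G * f = (1 - g) * G by rewrite /g subKr mulrAC.
apply/fpsP => n.
have -> : ((1 - g) * G) n = ((1 - g) * \sum_(k < n.+1) g ^+ k) n.
  rewrite !coef_fpsM; apply: eq_bigr => i _; congr (_ * _).
  rewrite /= coef_fps_sum.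
  rewrite (@big_ord_widen _ _ _ _ n.+1 (fun k => 1 * (g ^+ k) (n - i)%N));
    last by rewrite ltnS leq_subr.
  rewrite big_mkcond; apply: eq_bigr => k _.
  by case: ltnP => [_|lt_k]; [rewrite mul1r | rewrite coef_fpsX_lt].
have -> : (1 - g) * \sum_(k < n.+1) g ^+ k = 1 - g ^+ n.+1.
  by rewrite -opprB -[1 - g ^+ _]opprB subrX1 mulNr.
by rewrite coef_fpsB coef_fpsX_lt ?subr0.
Qed.

Fact fps_unitPl f g : g * f = 1 -> fps_unit f.
Proof.
move=> /fpsP /(_ 0%N); rewrite coef_fpsM0 coef_fps1 eqxx => gf1.
by apply/unitrPr; exists (g 0%N); rewrite mulrC.
Qed.

Fact fps_inv_out : {in [predC fps_unit], fps_inv =1 id}.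
Proof. by move=> f; rewrite inE /fps_inv => /negbTE ->. Qed.

HB.instance Definition _ := GRing.ComNzRing_hasMulInverse.Build (fps A)
  fps_mulVf fps_unitPl fps_inv_out.

Lemma fps_unitE f : (f \is a GRing.unit) = (f 0%N \is a GRing.unit).
Proof. by []. Qed.

Definition egf (a : nat -> A) : fps A := Fps (fun n => a n / n`!%:R).

Definition egf_coef f : nat -> A := fun n => n`!%:R * f n.

Lemma egfK (a : nat -> A) : (forall n, n`!%:R \is a @GRing.unit A) ->
  egf_coef (egf a) =1 a.
Proof. by move=> Ufact n; rewrite /egf_coef /= mulrC divrK. Qed.

Lemma egf_coefK f : (forall n, n`!%:R \is a @GRing.unit A) ->
  egf (egf_coef f) = f.
Proof. by move=> Ufact; apply/fpsP => n; rewrite /egf_coef /= mulrC mulKr. Qed.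

End FpsUnitRing.

(* (x)_{n,lam} = x (x - lam) ... (x - (n - 1) lam) *)
Definition dfalling (A : comNzRingType) (lam x : A) (n : nat) : A :=
  \prod_(i < n) (x - i%:R * lam).

(* e_lam^x(t) = (1 + lam t)^(x / lam) as a formal power series in t *)
Definition dexp (A : comUnitRingType) (lam x : A) : fps A :=
  egf (dfalling lam x).

(* R : realType is the field of real numbers and R[i] the complex numbers. *)
Section Polynomials.
Variable R : realType.
Local Notation C := R[i].
Local Notation PC c := (c%:P : {poly C}).

(* The generating functions live in C[x][[t]], with x the polynomial variable
   'X; their coefficients are therefore polynomials in x. *)
Definition dhermite_gf (lam : R) : fps {poly C} :=
  fps_comp (dexp (PC lam%:C%C) (-1)) (fps_t _ ^+ 2)
  * fps_comp (dexp (PC lam%:C%C) 'X) (2%:R * fps_t _).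

Definition dhermite (lam : R) (n : nat) : {poly C} :=
  egf_coef (dhermite_gf lam) n.

(* The division is that of C[x][[t]]: for u != 1 the constant coefficient
   1 - u of e_lam(t) - u is invertible (dfrobenius_euler_den_unit below). *)
Definition dfrobenius_euler_gf (lam : R) (r : nat) (u : C) : fps {poly C} :=
  (fps_const (PC (1 - u)) / (dexp (PC lam%:C%C) 1 - fps_const (PC u))) ^+ r
  * dexp (PC lam%:C%C) 'X.

Definition dfrobenius_euler (lam : R) (r : nat) (u : C) (n : nat) : {poly C} :=
  egf_coef (dfrobenius_euler_gf lam r u) n.

Lemma fact_polyC_unit (n : nat) : n`!%:R \is a @GRing.unit {poly C}.
Proof.
by rewrite -polyC_natr poly_unitE size_polyC coefC /= unitfE pnatr_eq0
  -lt0n fact_gt0.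
Qed.

Lemma dhermiteP (lam : R) : egf (dhermite lam) = dhermite_gf lam.
Proof. exact/egf_coefK/fact_polyC_unit. Qed.

Lemma dfrobenius_eulerP (lam : R) (r : nat) (u : C) :
  egf (dfrobenius_euler lam r u) = dfrobenius_euler_gf lam r u.
Proof. exact/egf_coefK/fact_polyC_unit. Qed.

Lemma dfrobenius_euler_den_unit (lam : R) (u : C) : u != 1 ->
  dexp (PC lam%:C%C) 1 - fps_const (PC u) \is a GRing.unit.
Proof.
move=> u_neq1; rewrite fps_unitE coef_fpsB /= /dfalling big_ord0 fact0 divr1.
have u1_neq0 : 1 - u != 0 by rewrite subr_eq0 eq_sym.
by rewrite -polyC1 -polyCB poly_unitE size_polyC coefC u1_neq0 unitfE.
Qed.

End Polynomials.

(* Main.v *)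
Require Import Defs.
From mathcomp Require Import all_boot all_order all_algebra.
From mathcomp Require Import reals.
From mathcomp Require Import complex ring.

Import Order.TTheory GRing.Theory Num.Theory.
Local Open Scope ring_scope.

(** Expanding (e_lam(t) - u)^r by the binomial theorem and e_lam^j = e_lam^(j)
    (a Vandermonde convolution), the definition of the Frobenius-Euler
    polynomials reads (1 - u)^r e_lam^x(t) =
    (sum_j C(r,j) (-u)^(r-j) e_lam^j(t)) (sum_k h_k(x|u) t^k / k!).
    Substitute 2t for t, multiply by e_lam^(-1)(t^2), and compare coefficients. *)

Lemma coef_fpsMn (A : zmodType) (f : fps A) (m n : nat) :
  (f *+ m) n = f n *+ m.
Proof. by elim: m => // m IHm; rewrite !mulrS coef_fpsD IHm. Qed.

Lemma coef_fps_tXn (A : comNzRingType) (k n : nat) :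
  (fps_t A ^+ k) n = (n == k)%:R.
Proof.
elim: k n => [|k IHk] n; first by rewrite expr0 coef_fps1.
rewrite exprS coef_fpsM; case: n => [|n]; first by rewrite big_ord1 /= mul0r.
rewrite 2!big_ord_recl /= mul0r add0r mul1r IHk subSS subn0 big1 ?addr0 //.
by move=> i _; rewrite mul0r.
Qed.

(** The substitution of [c * t] for [t], given coefficientwise so that its multiplicativity can be
    checked directly on Cauchy products. *)
Definition fps_scale (A : comNzRingType) (c : A) (f : fps A) : fps A :=
  Fps (fun n => c ^+ n * f n).

Lemma coef_fps_scale (A : comNzRingType) (c : A) (f : fps A) (n : nat) :
  fps_scale A c f n = c ^+ n * f n.
Proof. by []. Qed.

Lemma fps_scaleM (A : comNzRingType) (c : A) (f g : fps A) :
  fps_scale A c (f * g) = fps_scale A c f * fps_scale A c g.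
Proof.
apply/fpsP => n; rewrite /= mulr_sumr; apply: eq_bigr => i _.
by rewrite mulrACA -exprD subnKC // -ltnS.
Qed.

Lemma fps_comp_scale (A : comNzRingType) (m : nat) (f : fps A) :
  fps_comp f (m%:R * fps_t A) = fps_scale A m%:R f.
Proof.
have coefX k n : ((m%:R * fps_t A) ^+ k) n = (n == k)%:R *+ m ^ k.
  by rewrite exprMn -natrX mulr_natl coef_fpsMn coef_fps_tXn.
apply/fpsP => n; rewrite /= big_ord_recr big1 => [|k _] /=.
  by rewrite add0r coefX eqxx -natrX mulrC.
by rewrite coefX gtn_eqF // mul0rn mulr0.
Qed.

(** As [(t^2)^k = t^(2k)], only [k = n./2] can contribute, and only for even [n]. *)
Lemma coef_fps_comp_t2 (A : comNzRingType) (f : fps A) (n : nat) :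
  fps_comp f (fps_t A ^+ 2) n = if odd n then 0 else f n./2.
Proof.
have half_lt : (n./2 < n.+1)%N by rewrite ltnS -divn2 leq_div.
rewrite /= (bigD1 (Ordinal half_lt)) //= big1 ?addr0 => [|k /eqP neq_k].
  rewrite -exprM coef_fps_tXn mul2n.
  have -> : (n == n./2.*2) = ~~ odd n.
    by rewrite -[X in X == _]odd_double_half -[RHS]eqb0 -[RHS](eqn_add2r n./2.*2).
  by case: (odd n); rewrite ?mulr0 ?mulr1.
rewrite -exprM coef_fps_tXn; case: eqP => [def_n|]; last by rewrite mulr0.
by case: neq_k; apply: val_inj; rewrite /= (congr1 half def_n) mul2n doubleK.
Qed.

Lemma sum_even (A : nmodType) (F : nat -> A) (n : nat) :
  \sum_(i < n.+1) (if odd i then 0 else F i) =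
  \sum_(l < (n %/ 2).+1) F (2 * l)%N.
Proof.
rewrite divn2; elim: n => [|n IHn]; first by rewrite !big_ord1.
(* [n.+1./2] exceeds [n./2] only for odd [n], so the right-hand sum gains a term exactly when [n.+1]
   is even. *)
rewrite big_ord_recr IHn [n.+1./2]uphalf_half /=.
case: ifPn => [/negPf odd_n|/negPn odd_n]; first by rewrite odd_n addr0.
rewrite odd_n [RHS]big_ord_recr /= add1n; congr (_ + F _).
by rewrite mul2n doubleS -[in LHS](odd_double_half n) odd_n.
Qed.

Lemma coef_fps_comp_t2M (A : comNzRingType) (f g : fps A) (n : nat) :
  (fps_comp f (fps_t A ^+ 2) * g) n =
  \sum_(l < (n %/ 2).+1) f l * g (n - 2 * l)%N.
Proof.
pose F i := f i./2 * g (n - i)%N.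
rewrite (eq_bigr (fun l : 'I__ => F (2 * l)%N)) => [|l _]; last first.
  by rewrite /F mul2n doubleK.
rewrite -sum_even coef_fpsM; apply: eq_bigr => i _.
by rewrite coef_fps_comp_t2; case: ifP => // _; rewrite mul0r.
Qed.

(* The product rule (f g)' = f' g + f g'. *)
Lemma coef_fpsM_deriv (A : comNzRingType) (f g : fps A) (n : nat) :
  n.+1%:R * (f * g) n.+1 =
  \sum_(i < n.+1) (i.+1%:R * f i.+1 * g (n - i)%N +
                   f i * ((n - i).+1%:R * g (n - i).+1)).
Proof.
(* Each term of the Cauchy product is weighted by [n + 1 = i + (n + 1 - i)]. *)
have -> : n.+1%:R * (f * g) n.+1 =
    \sum_(i < n.+2) i%:R * f i * g (n.+1 - i)%N +
    \sum_(i < n.+2) f i * ((n.+1 - i)%:R * g (n.+1 - i)%N).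
  rewrite coef_fpsM mulr_sumr -big_split; apply: eq_bigr => i _ /=.
  rewrite [X in _ = _ + X]mulrCA -[in RHS]mulrA -mulrDl -natrD subnKC //.
  by rewrite -ltnS.
(* The weights vanish at [i = 0] in the first sum and at [i = n + 1] in the second; dropping these
   terms aligns the two ranges. *)
rewrite big_ord_recl !mul0r add0r [X in _ + X = _]big_ord_recr /=.
rewrite subnn mul0r mulr0 addr0 -big_split; apply: eq_bigr => i _.
by rewrite /bump /= add1n subSS subSn // -ltnS.
Qed.

Lemma rmorph_dfalling (A B : comNzRingType) (f : {rmorphism A -> B})
    (lam x : A) (n : nat) :
  f (dfalling lam x n) = dfalling (f lam) (f x) n.
Proof.
rewrite /dfalling rmorph_prod; apply: eq_bigr => i _.
by rewrite rmorphB rmorphM rmorph_nat.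
Qed.

Section DegenerateExponential.
Variable A : comUnitRingType.
Hypothesis nat_unit : forall n, n.+1%:R \is a @GRing.unit A.

Lemma fact_unit (n : nat) : n`!%:R \is a @GRing.unit A.
Proof.
elim: n => [|n IHn]; first by rewrite fact0 unitr1.
by rewrite factS natrM unitrM nat_unit.
Qed.

(** The differential equation [(1 + lam t) y' = x y], read off coefficientwise. *)
Lemma coef_dexpS (lam x : A) (n : nat) :
  n.+1%:R * dexp lam x n.+1 = (x - n%:R * lam) * dexp lam x n.
Proof.
rewrite /= /dfalling big_ord_recr /= factS natrM invrM ?nat_unit ?fact_unit //.
by rewrite mulrC -!mulrA mulVr ?nat_unit // mulr1 mulrCA.
Qed.

(* Both sides have constant term 1 and satisfy
   (n + 1) c_(n+1) = (x + y - n lam) c_n. *)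
Lemma dexpD (lam x y : A) : dexp lam (x + y) = dexp lam x * dexp lam y.
Proof.
apply/fpsP; elim=> [|n IHn].
  by rewrite coef_fpsM0 /= /dfalling !big_ord0 fact0 divr1 mulr1.
apply: (mulrI (nat_unit n)); rewrite coef_dexpS IHn coef_fpsM_deriv.
rewrite coef_fpsM mulr_sumr; apply: eq_bigr => i _.
(* The factors [x - i lam] and [y - (n - i) lam] add up to [x + y - n lam], independently of [i]. *)
rewrite !coef_dexpS [X in _ = _ + X]mulrCA -[in RHS]mulrA -mulrDl.
by rewrite addrACA -opprD -mulrDl -natrD subnKC // -ltnS.
Qed.

Lemma dexpX (lam x : A) (j : nat) : dexp lam x ^+ j = dexp lam (x *+ j).
Proof.
elim: j => [|j IHj]; last by rewrite exprS IHj -dexpD mulrS.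
apply/fpsP => -[|n]; rewrite expr0 coef_fps1 /=.
  by rewrite /dfalling big_ord0 fact0 divr1.
(* At [x *+ 0] the factor of index 0 in the falling factorial is zero. *)
by rewrite /dfalling big_ord_recl mul0r subrr !mul0r.
Qed.

End DegenerateExponential.

Lemma fps_constX (A : comNzRingType) (c : A) (k : nat) :
  fps_const c ^+ k = fps_const (c ^+ k).
Proof.
elim: k => [|k IHk]; first by rewrite expr0.
rewrite exprS IHk exprS; apply/fpsP => n; rewrite coef_fps_constM /=.
by case: eqP; rewrite ?mulr0.
Qed.

Lemma dexp_polyC (F : fieldType) (lam x : F) (n : nat) :
  dexp lam%:P x%:P n = (dexp lam x n)%:P.
Proof.
by rewrite /= -rmorph_dfalling polyCM -polyC_natr polyCV.
Qed.

Section FrobeniusEuler.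
Variables (R : realType) (lam : R) (r : nat) (u : R[i]).
Hypothesis u_neq1 : u != 1.
Local Notation lamP := ((lam%:C)%C%:P : {poly R[i]}).

Definition dexp_binomial : fps {poly R[i]} :=
  \sum_(j < r.+1)
    fps_const ((- u) ^+ (r - j))%:P * dexp lamP j%:R *+ 'C(r, j).

Lemma natP_unit (n : nat) : n.+1%:R \is a @GRing.unit {poly R[i]}.
Proof. by rewrite -polyC_natr poly_unitE size_polyC coefC unitfE pnatr_eq0. Qed.

Lemma dexp_binomialE :
  (dexp lamP 1 - fps_const u%:P) ^+ r = dexp_binomial.
Proof.
have -> : dexp lamP 1 - fps_const u%:P = fps_const (- u)%:P + dexp lamP 1.
  apply/fpsP => n; rewrite coef_fpsB coef_fpsD addrC polyCN; congr (_ + _) => /=.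
  by case: eqP; rewrite ?oppr0.
rewrite exprDn; apply: eq_bigr => j _.
by rewrite fps_constX (dexpX _ natP_unit) -polyC_exp.
Qed.

(** The denominator may be cleared because [u != 1] makes [e_lam(t) - u] invertible. *)
Lemma dfrobenius_euler_gfE :
  fps_const ((1 - u) ^+ r)%:P * dexp lamP 'X =
  dexp_binomial * dfrobenius_euler_gf lam r u.
Proof.
have Uden := dfrobenius_euler_den_unit lam u_neq1.
rewrite /dfrobenius_euler_gf -dexp_binomialE mulrA -exprMn mulrCA.
by rewrite divrr // mulr1 fps_constX polyC_exp.
Qed.

Lemma dhermite_gfE :
  fps_const ((1 - u) ^+ r)%:P * dhermite_gf lam =
  fps_scale _ 2%:R (dfrobenius_euler_gf lam r u) *
    (fps_comp (dexp lamP (-1)) (fps_t _ ^+ 2) * fps_scale _ 2%:R dexp_binomial).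
Proof.
rewrite /dhermite_gf fps_comp_scale mulrCA [RHS]mulrCA -fps_scaleM.
rewrite [_ * dexp_binomial]mulrC -dfrobenius_euler_gfE; congr (_ * _).
(* A constant factor is unaffected by the substitution of [2t] for [t]. *)
by apply/fpsP => n; rewrite !(coef_fps_constM, coef_fps_scale) mulrCA.
Qed.

Lemma coef_dexp_binomial (m : nat) :
  dexp_binomial m =
  \sum_(j < r.+1) ((- u) ^+ (r - j) * dexp lam%:C%C j%:R m *+ 'C(r, j))%:P.
Proof.
rewrite coef_fps_sum; apply: eq_bigr => j _.
by rewrite coef_fpsMn coef_fps_constM -polyC_natr dexp_polyC -polyCM -polyCMn.
Qed.

(** Identifies the bracket multiplying [h_k(x|u)]: [2 ^+ k] comes from the rescaled Frobenius-Euler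
    series, and [k!] turns its coefficient into [h_k]. *)
Lemma coef_connection (k n : nat) : (k <= n)%N ->
  n`!%:R * (2%:R ^+ k * (fps_comp (dexp lamP (-1)) (fps_t _ ^+ 2) *
    fps_scale _ 2%:R dexp_binomial) (n - k)%N) =
  (\sum_(j < r.+1) \sum_(l < ((n - k) %/ 2).+1)
       'C(n, k)%:R * 'C(r, j)%:R * dfalling lam%:C%C (-1) l * (n - k)`!%:R
       / (l`!%:R * (n - k - 2 * l)`!%:R)
       * (- u) ^+ (r - j) * 2%:R ^+ (n - 2 * l)
       * dfalling lam%:C%C j%:R (n - k - 2 * l))%:P * k`!%:R.
Proof.
move=> le_kn; rewrite coef_fps_comp_t2M exchange_big rmorph_sum.
rewrite !mulr_sumr mulr_suml; apply: eq_bigr => l _.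
rewrite coef_fps_scale coef_dexp_binomial rmorph_sum !mulr_sumr mulr_suml.
apply: eq_bigr => j _.
have le_lm : (2 * l <= n - k)%N.
  by rewrite mulnC -leq_divRL // -ltnS.
have -> : dexp lamP (-1) l = (dexp lam%:C%C (-1) l)%:P.
  by rewrite -dexp_polyC polyCN polyC1.
rewrite -!polyC_natr -!polyC_exp -!polyCM.
(* All factors are constant polynomials, so the identity descends to [R[i]]; there [n!] is split as
   [C(n,k) k! (n-k)!]. *)
congr (_%:P); rewrite /= -(bin_fact le_kn) !natrM invfM.
(* The power of 2 collects the rescalings of both series; [le_lm] keeps the subtraction from
   truncating. *)
have -> : (n - 2 * l = k + (n - k - 2 * l))%N by rewrite addnBA // subnKC.
rewrite exprD -[_ *+ 'C(r, j)]mulr_natl; ring.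
Qed.

End FrobeniusEuler.

Theorem theorem10 (R : realType) (lam : R) (lam_neq0 : lam != 0)
    (r : nat) (r_gt0 : (0 < r)%N) (u : R[i]) (u_neq1 : u != 1) (n : nat) :
  dhermite lam n =
  (1 / (1 - u) ^+ r) *:
  \sum_(k < n.+1)
    (\sum_(j < r.+1) \sum_(l < ((n - k) %/ 2).+1)
       'C(n, k)%:R * 'C(r, j)%:R * dfalling lam%:C%C (-1) l * (n - k)`!%:R
       / (l`!%:R * (n - k - 2 * l)`!%:R)
       * (- u) ^+ (r - j) * 2%:R ^+ (n - 2 * l)
       * dfalling lam%:C%C j%:R (n - k - 2 * l))
    *: dfrobenius_euler lam r u k.
Proof.
have c_neq0 : (1 - u) ^+ r != 0 by rewrite expf_neq0 // subr_eq0 eq_sym.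
(* With [(1 - u) ^+ r] moved to the left, the goal is [n!] times the coefficient of [t^n] in
   [dhermite_gfE]. *)
apply: (scalerI c_neq0); rewrite scalerA div1r divff // scale1r.
rewrite -mul_polyC /dhermite /egf_coef mulrCA -coef_fps_constM dhermite_gfE //.
rewrite coef_fpsM mulr_sumr; apply: eq_bigr => k _.
have le_kn : (k <= n)%N by rewrite -ltnS.
rewrite coef_fps_scale -mul_polyC [X in _ * X]mulrAC mulrA.
by rewrite coef_connection // -mulrA.
Qed.
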